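(* Let $L$ be a finite-dimensional Lie algebra over $\mathbb{F}$, and let $I$ and $J$ be two perfect ideals of $L$. Then $I+J$ is also a perfect ideal of $L$.
   Context: $\mathbb{F}$ denotes either the field of real numbers or the field of complex numbers. For ideals $I,J$ of a Lie algebra $L$, $I+J=\{x+y: x\in I, y\in J\}$ and $[I,J]$ is the linear span of all brackets $[x,y]$ with $x\in I$, $y\in J$; both are ideals of $L$. A Lie algebra $M$ is called perfect if $[M,M]=M$ (the zero Lie algebra is perfect). An ideal $I$ of $L$ is called a perfect ideal if $I$ is itself a perfect Lie algebra, i.e. $[I,I]=I$. *)

(* Defs.v *)
From HB Require Import structures.
From mathcomp Require Import all_boot all_order all_algebra.
From mathcomp Require Import boolp classical_sets reals complex.

Set Implicit Arguments.
Unset Strict Implicit.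
Unset Printing Implicit Defensive.

Import GRing.Theory.

Local Open Scope classical_set_scope.
Local Open Scope ring_scope.

Variant scalar_kind := RealScalars | ComplexScalars.

Definition scalar_field (R : realType) (k : scalar_kind) : fieldType :=
  match k with
  | RealScalars => R
  | ComplexScalars => complex R
  end.

HB.mixin Record Vector_isLie (F : fieldType) L of Vector F L := {
  lie_bracket : L -> L -> L;
  lie_bracket_linearl : forall y, linear (lie_bracket^~ y);
  lie_bracket_linearr : forall x, linear (lie_bracket x);
  lie_bracketxx : forall x, lie_bracket x x = 0;
  lie_jacobi : forall x y z,
    lie_bracket x (lie_bracket y z) + lie_bracket y (lie_bracket z x)
    + lie_bracket z (lie_bracket x y) = 0
}.

(* Finite-dimensionality is part of [Vector]. *)
#[short(type="lieAlgType")]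
HB.structure Definition LieAlgebra (F : fieldType) :=
  { L of Vector F L & Vector_isLie F L }.

Section LieIdeals.
Variables (F : fieldType) (L : lieAlgType F).
Implicit Types (I J : {vspace L}) (A : set L).

Definition linear_span A : set L :=
  [set v | exists s : seq L, (forall u, u \in s -> A u) /\ v \in <<s>>%VS].

Definition lie_product I J : set L :=
  linear_span [set lie_bracket x y | x in [set` I] & y in [set` J]].

Definition is_ideal I : Prop :=
  forall x y : L, y \in I -> lie_bracket x y \in I.

(* The bracket of the Lie algebra [I] is the restriction of that of [L], so
   [I, I] can be computed in [L]. *)
Definition is_perfect_ideal I : Prop :=
  is_ideal I /\ lie_product I I = [set` I].

End LieIdeals.

(* Main.v *)
Require Import Defs.
From HB Require Import structures.
From mathcomp Require Import all_boot all_order all_algebra.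
From mathcomp Require Import boolp classical_sets reals complex.

(** The bracket of ideals is monotone, so [I + J, I + J] contains both
    [I, I] = I and [J, J] = J, hence I + J, because it is a linear subspace
    ([linear_spanD], [lie_product_mono]).  Conversely, I + J is an ideal
    ([is_ideal_add]), and an ideal contains its own brackets
    ([lie_product_ideal_sub]). *)

Local Open Scope ring_scope.

Lemma lie_bracketDr {F : fieldType} {L : lieAlgType F} (x y z : L) :
  lie_bracket x (y + z) = lie_bracket x y + lie_bracket x z.
Proof. by have := lie_bracket_linearr x 1 y z; rewrite !GRing.scale1r. Qed.

Lemma linear_span_mono {F : fieldType} {L : lieAlgType F} (A B : set L) :
  (A `<=` B -> linear_span A `<=` linear_span B)%classic.
Proof. by move=> sAB v [s [sA vs]]; exists s; split=> // u /sA/sAB. Qed.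

Lemma linear_spanD {F : fieldType} {L : lieAlgType F} (A : set L) (u v : L) :
  linear_span A u -> linear_span A v -> linear_span A (u + v).
Proof.
move=> [s [sA us]] [t [tA vt]]; exists (s ++ t); split.
  by move=> w; rewrite mem_cat => /orP[/sA|/tA].
by rewrite span_cat memv_add.
Qed.

Lemma linear_span_sub {F : fieldType} {L : lieAlgType F}
    (A : set L) (U : {vspace L}) :
  (A `<=` [set` U] -> linear_span A `<=` [set` U])%classic.
Proof. by move=> sAU v [s [sA vs]]; apply: subvP vs; apply/span_subvP => u /sA/sAU. Qed.

Lemma lie_product_mono {F : fieldType} {L : lieAlgType F}
    (I I' J J' : {vspace L}) :
  (I <= I')%VS -> (J <= J')%VS ->
  (lie_product I J `<=` lie_product I' J')%classic.
Proof.
move=> /subvP sI /subvP sJ; apply: linear_span_mono => _ [x Ix [y Jy <-]].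
by exists x; [exact: sI | exists y; first exact: sJ].
Qed.

Lemma lie_product_ideal_sub {F : fieldType} {L : lieAlgType F}
    (U I : {vspace L}) :
  is_ideal I -> (lie_product U I `<=` [set` I])%classic.
Proof. by move=> idI; apply: linear_span_sub => _ [x _ [y Iy <-]]; apply: idI. Qed.

Lemma is_ideal_add {F : fieldType} {L : lieAlgType F} (I J : {vspace L}) :
  is_ideal I -> is_ideal J -> is_ideal (I + J)%VS.
Proof.
move=> idI idJ x _ /memv_addP[a Ia [b Jb ->]].
by rewrite lie_bracketDr memv_add ?idI ?idJ.
Qed.

Lemma is_perfect_ideal_add {F : fieldType} {L : lieAlgType F}
    (I J : {vspace L}) :
  is_perfect_ideal I -> is_perfect_ideal J -> is_perfect_ideal (I + J)%VS.
Proof.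
move=> [idI pI] [idJ pJ]; have idIJ := is_ideal_add I J idI idJ.
split=> //; apply/seteqP; split; first exact: lie_product_ideal_sub.
move=> _ /memv_addP[a Ia [b Jb ->]]; apply: linear_spanD.
- apply: (lie_product_mono I _ I _ (addvSl I J) (addvSl I J)).
  by rewrite pI.
- apply: (lie_product_mono J _ J _ (addvSr I J) (addvSr I J)).
  by rewrite pJ.
Qed.

Theorem proposition2p1 (R : realType) (k : scalar_kind)
    (L : lieAlgType (scalar_field R k)) (I J : {vspace L}) :
  is_perfect_ideal I -> is_perfect_ideal J -> is_perfect_ideal (I + J)%VS.
Proof. exact: is_perfect_ideal_add. Qed.
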